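(* An electrostatic potential in $d$-dimensional space with $n \geq 2$ charges with magnitudes $q_1, \dots, q_n \in \mathbb{R}\setminus\{0\}$ admits an equilibrium point in each of the following cases: - the dimension $d$ is even and $\sum_{i} q_i \neq 0$; - the dimension $d$ is odd and either (1) $\sum_i q_i > 0$ and $n_+ \neq n_- + 1$, or (2) $\sum_i q_i < 0$ and $n_- \neq n_+ + 1$, where $n_+$ and $n_-$ denote the number of positive and negative charges, respectively.
   Context: The electrostatic potential of charges $q_1,\dots,q_n$ at distinct locations $a_1,\dots,a_n \in \mathbb{R}^d$ is $f(x) = \sum_{i=1}^n \frac{q_i}{\|x-a_i\|}$ for $x \in \mathbb{R}^d\setminus\{a_1,\dots,a_n\}$, with $\|\cdot\|$ the Euclidean norm. An equilibrium point is a point $x \in \mathbb{R}^d\setminus\{a_1,\dots,a_n\}$ with $\nabla f(x) = 0$. *)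

(* Defs.v *)
From mathcomp Require Import all_boot all_order all_algebra.
From mathcomp Require Import all_classical all_reals all_analysis.

Set Implicit Arguments.
Unset Strict Implicit.
Unset Printing Implicit Defensive.

Import Order.TTheory GRing.Theory Num.Theory.
Import numFieldNormedType.Exports.

Local Open Scope ring_scope.

(* The library norm `|x| on 'rV[R]_d is the sup norm, hence this definition;
   the two induce the same topology and the same notion of derivative. *)
Definition enorm (R : realType) (d : nat) (x : 'rV[R]_d) : R :=
  Num.sqrt (\sum_(j < d) x 0 j ^+ 2).

(* Total on 'rV[R]_d because 0^-1 = 0; meaningful only off the points a i. *)
Definition potential (R : realType) (d n : nat)
    (q : 'I_n -> R) (a : 'I_n -> 'rV[R]_d) (x : 'rV[R]_d) : R :=
  \sum_(i < n) q i / enorm (x - a i).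

Definition gradient (R : realType) (d : nat) (f : 'rV[R]_d -> R)
    (x : 'rV[R]_d) : 'rV[R]_d :=
  \row_(j < d) 'D_(delta_mx 0 j) f x.

(* Differentiability is automatic off the charges. It is recorded only because
   'D_v f x has a default value where f has no derivative. *)
Definition equilibrium_point (R : realType) (d n : nat)
    (q : 'I_n -> R) (a : 'I_n -> 'rV[R]_d) (x : 'rV[R]_d) : Prop :=
  [/\ forall i, x != a i,
      differentiable (potential q a) x
    & gradient (potential q a) x = 0].

Definition num_pos (R : realType) (n : nat) (q : 'I_n -> R) : nat :=
  #|[set i | 0 < q i]|.

Definition num_neg (R : realType) (n : nat) (q : 'I_n -> R) : nat :=
  #|[set i | q i < 0]|.

(* Main.v *)
(* Off the charges the gradient of the potential f is an explicit continuous
   field G; suppose that it has no zero there.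

   Dimension d >= 2.  A suitable continuous step along G gives a map T of the
   complement X of the charges into itself with f (T x) > f x.  By compactness
   an orbit of T that stays bounded reaches arbitrarily high values of f, hence
   falls into a positive charge.  An orbit can escape to infinity only if the
   total charge is negative, since otherwise f tends to 0 from above.  So X is
   a disjoint union of open basins, one for each positive charge and one for
   infinity if the total charge is negative.  As X is connected, there is at
   most one basin.  Let the total charge be positive, so that some charge is
   positive.  If two are, this is contradictory; otherwise reverse all charges:
   a negative one becomes positive, and infinity becomes a second sink.  Hence
   for d >= 2 the numbers of charges of each sign play no role.

   Dimension 1.  Let the total charge be positive.  The force keeps a constant
   sign between charges, points away from positive charges, towards negative
   ones, and outwards near infinity.  Hence the signs of the charges alternate
   and both extreme charges are positive, so there is exactly one more positive
   charge than negative ones. *)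
Require Import Defs.
From mathcomp Require Import all_boot all_order all_algebra.
From mathcomp Require Import all_classical all_reals all_analysis.
From mathcomp Require Import ring lra.
Import Order.TTheory GRing.Theory Num.Theory.
Import numFieldNormedType.Exports.
Local Open Scope classical_set_scope.
Local Open Scope ring_scope.

Set Implicit Arguments.
Unset Strict Implicit.

(** * The Euclidean norm *)

Definition dot (R : realType) (d : nat) (u v : 'rV[R]_d) : R :=
  \sum_(j < d) u 0 j * v 0 j.

Lemma dot_ge0 (R : realType) (d : nat) (x : 'rV[R]_d) : 0 <= dot x x.
Proof. by apply: sumr_ge0 => j _; rewrite -expr2 sqr_ge0. Qed.

Lemma dot_gt0 (R : realType) (d : nat) (x : 'rV[R]_d) : x != 0 -> 0 < dot x x.
Proof.
move=> x0; have /existsP[j xj] : [exists j, x 0 j != 0].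
  apply: contraNT x0 => /existsPn h; apply/eqP/rowP => j; rewrite mxE.
  by apply/eqP; move: (h j); rewrite negbK.
rewrite /dot (bigD1 j) //= ltr_pwDl //; first by rewrite -expr2 exprn_even_gt0.
by apply: sumr_ge0 => k _; rewrite -expr2 sqr_ge0.
Qed.

Lemma enormE (R : realType) (d : nat) (x : 'rV[R]_d) :
  enorm x = Num.sqrt (dot x x).
Proof. by rewrite /enorm; congr Num.sqrt; apply: eq_bigr => j _; rewrite expr2. Qed.

Lemma enorm_ge0 (R : realType) (d : nat) (x : 'rV[R]_d) : 0 <= enorm x.
Proof. exact: sqrtr_ge0. Qed.

Lemma enorm_gt0 (R : realType) (d : nat) (x : 'rV[R]_d) : x != 0 -> 0 < enorm x.
Proof. by move=> x0; rewrite enormE sqrtr_gt0 dot_gt0. Qed.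

Lemma enorm_sqr (R : realType) (d : nat) (x : 'rV[R]_d) : enorm x ^+ 2 = dot x x.
Proof. by rewrite enormE sqr_sqrtr // dot_ge0. Qed.

Lemma normr_coord (R : realType) (d : nat) (x : 'rV[R]_d) j : `|x 0 j| <= `|x|.
Proof.
by rewrite [leRHS]/Num.Def.normr /= mx_normrE; apply/bigmax_geP; right => /=; exists (0, j).
Qed.

Lemma normr_le_coord (R : realType) (d : nat) (x : 'rV[R]_d) e : 0 <= e ->
  (forall j, `|x 0 j| <= e) -> `|x| <= e.
Proof.
move=> e0 h; rewrite [leLHS]/Num.Def.normr /= mx_normrE; apply/bigmax_leP; split => //.
by move=> [i j] _ /=; rewrite ord1.
Qed.

(** Paired with [enorm_le_normr]: the potential is built on the Euclidean norm, while radii and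
    topology below use the sup norm. *)
Lemma normr_le_enorm (R : realType) (d : nat) (x : 'rV[R]_d) : `|x| <= enorm x.
Proof.
apply: normr_le_coord; first exact: enorm_ge0.
move=> j; rewrite -sqrtr_sqr ler_wsqrtr // (bigD1 j) //= lerDl.
by apply: sumr_ge0 => k _; rewrite sqr_ge0.
Qed.

Lemma enorm_le_normr (R : realType) (d : nat) (x : 'rV[R]_d) :
  enorm x <= d%:R * `|x|.
Proof.
rewrite enormE -[leRHS]ger0_norm ?mulr_ge0 // -sqrtr_sqr ler_wsqrtr //.
apply: (@le_trans _ _ (\sum_(j < d) `|x| ^+ 2)).
  apply: ler_sum => j _; rewrite -expr2 -real_normK ?num_real //.
  by rewrite lerXn2r ?nnegrE // normr_coord.
rewrite sumr_const card_ord -[leLHS]mulr_natl exprMn ler_wpM2r ?sqr_ge0 //.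
by rewrite -natrX ler_nat; case: d {x} => // d; rewrite leq_pmulr.
Qed.

(** Cauchy-Schwarz: the square of [enorm y *: x - enorm x *: y] is nonnegative and equals
    [2 * enorm x * enorm y] times the gap in the inequality. *)
Lemma dot_le_enorm (R : realType) (d : nat) (x y : 'rV[R]_d) :
  dot x y <= enorm x * enorm y.
Proof.
have [->|x0] := eqVneq x 0.
  rewrite /dot big1 ?mulr_ge0 ?enorm_ge0 // => j _.
  by rewrite mxE mul0r.
have [->|y0] := eqVneq y 0.
  rewrite /dot big1 ?mulr_ge0 ?enorm_ge0 // => j _.
  by rewrite mxE mulr0.
have ex := enorm_gt0 x0; have ey := enorm_gt0 y0.
have : 0 <= dot (enorm y *: x - enorm x *: y) (enorm y *: x - enorm x *: y).
  exact: dot_ge0.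
have -> : dot (enorm y *: x - enorm x *: y) (enorm y *: x - enorm x *: y) =
   enorm y ^+ 2 * dot x x + enorm x ^+ 2 * dot y y
     - (enorm x * enorm y * 2) * dot x y.
  rewrite /dot !mulr_sumr -sumrN -!big_split /=; apply: eq_bigr => j _.
  by rewrite !mxE; ring.
rewrite -!enorm_sqr => h.
have := mulr_gt0 ex ey; nra.
Qed.

Lemma ler_enormD (R : realType) (d : nat) (x y : 'rV[R]_d) :
  enorm (x + y) <= enorm x + enorm y.
Proof.
rewrite -(@ler_pXn2r _ 2) ?nnegrE ?addr_ge0 ?enorm_ge0 // sqrrD !enorm_sqr.
have -> : dot (x + y) (x + y) = dot x x + dot x y *+ 2 + dot y y.
  rewrite /dot -[_ *+ 2]mulr_natl mulr_sumr -!big_split /=; apply: eq_bigr => j _.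
  by rewrite !mxE; ring.
by rewrite lerD2r lerD2l lerMn2r dot_le_enorm orbT.
Qed.

Lemma enormN (R : realType) (d : nat) (x : 'rV[R]_d) : enorm (- x) = enorm x.
Proof. by rewrite /enorm; congr Num.sqrt; apply: eq_bigr => j _; rewrite mxE sqrrN. Qed.

Lemma ler_dist_enorm (R : realType) (d : nat) (x y : 'rV[R]_d) :
  `|enorm (x - y) - enorm x| <= enorm y.
Proof.
rewrite ler_norml; have := ler_enormD x (- y).
have := ler_enormD (x - y) y; rewrite subrK enormN; lra.
Qed.

(** * Size of the potential near the charges and near infinity *)

Lemma uniform_radius (R : realType) (T : finType) (P : T -> R -> Prop) :
  (forall i r s, s <= r -> P i r -> P i s) ->
  (forall i, exists2 r, 0 < r & P i r) ->
  exists2 r, 0 < r & forall i, P i r.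
Proof.
move=> mono /(_ _)/cid2 h; pose r i := s2val (h i).
(* The default 1 keeps the minimum positive when [T] is empty. *)
exists (\big[Order.min/1]_i r i).
  by apply: lt_bigmin => // i _; exact: (s2valP (h i)).
move=> i; apply: mono (s2valP' (h i)); exact: bigmin_le.
Qed.

Lemma separation (R : realType) (d n : nat) (a : 'I_n -> 'rV[R]_d) :
  injective a ->
  exists2 r, 0 < r & forall i k, i != k -> r <= `|a i - a k|.
Proof.
move=> inja.
have [||r r0 h] := @uniform_radius R ('I_n * 'I_n)%type
  (fun p r => p.1 != p.2 -> r <= `|a p.1 - a p.2|).
- by move=> p r s sr h /h; exact: le_trans.
- move=> [i k] /=; have [->|ik] := eqVneq i k; first by exists 1.
  by exists `|a i - a k| => //; rewrite normr_gt0 subr_eq0 (inj_eq inja).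
by exists r => // i k; exact: (h (i, k)).
Qed.

Lemma potentialN (R : realType) (d n : nat) (q : 'I_n -> R)
    (a : 'I_n -> 'rV[R]_d) x :
  potential (fun i => - q i) a x = - potential q a x.
Proof. by rewrite /potential -sumrN; apply: eq_bigr => i _; rewrite mulNr. Qed.

(** If every positive charge is at distance at least [r], each of their terms is at most
    [|q i| / r], and negative charges only lower the sum. *)
Lemma potential_gt_near_pos (R : realType) (d n : nat) (q : 'I_n -> R)
    (a : 'I_n -> 'rV[R]_d) x r :
  0 < r -> (\sum_i `|q i|) / r < potential q a x ->
  exists2 i, 0 < q i & `|x - a i| < r.
Proof.
move=> r0; apply: contraPP => /forall2NP h; apply/negP; rewrite -leNgt.
rewrite mulr_suml; apply: ler_sum => i _.
have [qi|qi] := leP (q i) 0.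
  apply: (@le_trans _ _ 0); first by rewrite mulr_le0_ge0 ?invr_ge0 ?enorm_ge0.
  by rewrite mulr_ge0 // invr_ge0 ltW.
have [/negP|/negP] := h i; first by rewrite qi.
rewrite -leNgt => ri; have ei := le_trans ri (normr_le_enorm _).
rewrite gtr0_norm // ler_pM2l // lef_pV2 // posrE //.
exact: lt_le_trans ei.
Qed.

Lemma potential_abs_le (R : realType) (d n : nat) (q : 'I_n -> R)
    (a : 'I_n -> 'rV[R]_d) x r :
  0 < r -> (forall i, r <= `|x - a i|) ->
  `|potential q a x| <= (\sum_i `|q i|) / r.
Proof.
move=> r0 h; rewrite ler_norml lerNl; apply/andP; split; rewrite leNgt; apply/negP.
- have -> : \sum_i `|q i| = \sum_i `|- q i| by apply: eq_bigr => i _; rewrite normrN.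
  by rewrite -potentialN => /(potential_gt_near_pos r0)[i _]; rewrite ltNge h.
- by move=> /(potential_gt_near_pos r0)[i _]; rewrite ltNge h.
Qed.

(** Close to [a i] the other charges stay at a distance bounded below, so their contribution is
    bounded while the term of [i] blows up. *)
Lemma potential_near_pos (R : realType) (d n : nat) (q : 'I_n -> R)
    (a : 'I_n -> 'rV[R]_d) i M :
  injective a -> 0 < q i ->
  exists2 r, 0 < r &
    forall x, x != a i -> `|x - a i| < r -> M < potential q a x.
Proof.
move=> inja qi; have [t t0 sep] := separation inja.
set S := \sum_k `|q k|; have S0 : 0 <= S by exact: sumr_ge0.
pose N : R := `|M| + S / (t / 2) + 1.
have N0 : 0 < N by rewrite ltr_wpDl // addr_ge0 // divr_ge0 // divr_ge0 // ltW.
(* The first bound keeps the other charges at distance [t / 2]. The second makes the term of [i] at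
   least [N]; [d.+1] comes from comparing the norms and is nonzero even for [d = 0]. *)
exists (Order.min (t / 2) (q i / (d.+1%:R * N))).
  by rewrite lt_min !divr_gt0 // mulr_gt0.
move=> x xa; rewrite lt_min => /andP[x1 x2].
have e0 : 0 < enorm (x - a i) by rewrite enorm_gt0 // subr_eq0.
have : N <= q i / enorm (x - a i).
  rewrite ler_pdivlMr //; move: x2.
  rewrite ltr_pdivlMr ?mulr_gt0 // => /ltW; apply: le_trans.
  rewrite mulrA mulrC ler_pM2r // mulrC.
  by apply: le_trans (enorm_le_normr _) _; rewrite ler_wpM2r // ler_nat.
have : - (S / (t / 2)) <= \sum_(k | k != i) q k / enorm (x - a k).
  rewrite /S mulr_suml -sumrN (bigID (fun k => k != i)) /=.
  rewrite -[leRHS]addr0; apply: lerD; last first.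
    by apply: sumr_le0 => k _; rewrite oppr_le0 divr_ge0 // divr_ge0 // ltW.
  apply: ler_sum => k ki.
  have tk : t / 2 <= enorm (x - a k).
    apply: le_trans (normr_le_enorm _).
    have := sep _ _ ki; have := ler_distD x (a k) (a i).
    rewrite (distrC (a k) x). move: x1 t0. lra.
  have tk0 : 0 < t / 2 by lra.
  rewrite lerNl -mulNr; apply: le_trans (_ : `|q k| / enorm (x - a k) <= _).
    by rewrite ler_wpM2r ?invr_ge0 ?enorm_ge0 // -normrN ler_norm.
  rewrite ler_wpM2l // lef_pV2 // posrE //; exact: lt_le_trans tk.
move=> h1; rewrite /N => h2; rewrite /potential (bigD1 i) //=; have := ler_norm M; lra.
Qed.

(** The potential exceeds [M] near a positive charge and drops below [m] near a negative one. As [r]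
    does not depend on [x], an orbit with potential in a band keeps a fixed distance from the
    charges, as compactness will require. *)
Lemma bounded_potential_away (R : realType) (d n : nat) (q : 'I_n -> R)
    (a : 'I_n -> 'rV[R]_d) m M :
  injective a -> (forall i, q i != 0) ->
  exists2 r, 0 < r & forall x, (forall i, x != a i) ->
    m <= potential q a x <= M -> forall i, r <= `|x - a i|.
Proof.
move=> inja q0.
have [||r r0 h] := @uniform_radius R 'I_n (fun i r => forall x, x != a i ->
   m <= potential q a x <= M -> r <= `|x - a i|).
- by move=> i r s sr h x xa /(h _ xa); exact: le_trans.
- move=> i; have [qi|qi|/eqP] := ltgtP (q i) 0; last by rewrite (negbTE (q0 i)).
  + have qi' : 0 < - q i by lra.
    have [r r0 h] := @potential_near_pos _ _ _ (fun i => - q i) a i (- m) inja qi'.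
    exists r => // x xa hx; rewrite leNgt; apply/negP => xr.
    by have := h _ xa xr; rewrite potentialN; lra.
  + have [r r0 h] := potential_near_pos M inja qi.
    exists r => // x xa hx; rewrite leNgt; apply/negP => xr.
    by have := h _ xa xr; lra.
by exists r => // x xa hx i; exact: h.
Qed.

(** Multiplied by [enorm x], the potential tends to the total charge: the ratio of [enorm x] to
    [enorm (x - a i)] differs from 1 by at most [A / r]. *)
Lemma potential_infty_pos (R : realType) (d n : nat) (q : 'I_n -> R)
    (a : 'I_n -> 'rV[R]_d) :
  0 < \sum_i q i ->
  exists2 r, 0 < r & forall x, r <= `|x| -> 0 < potential q a x.
Proof.
set Q := \sum_i q i => Q0.
set S := \sum_i `|q i|; have S0 : 0 <= S by exact: sumr_ge0.
set A := \sum_i enorm (a i).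
have A0 : 0 <= A by apply: sumr_ge0 => i _; exact: enorm_ge0.
have aA i : enorm (a i) <= A.
  by rewrite /A (bigD1 i) //= lerDl sumr_ge0 // => k _; exact: enorm_ge0.
(* Chosen so that the total error [S * A / r] is smaller than [Q]. *)
pose r := S * A / Q + 1.
have r0 : 0 < r by rewrite ltr_wpDl // divr_ge0 ?mulr_ge0 // ltW.
exists (A + r); first by rewrite ltr_wpDl.
move=> x xr; have ex := le_trans xr (normr_le_enorm _).
have ex0 : 0 < enorm x by lra.
have eax i : r <= enorm (x - a i) /\ enorm x - enorm (x - a i) <= A /\
    enorm (x - a i) - enorm x <= A.
  by have := ler_dist_enorm x (a i); rewrite ler_norml; have := aA i; lra.
rewrite -(pmulr_lgt0 _ ex0) /potential mulr_suml.
suff : Q - S * A / r <= \sum_i q i / enorm (x - a i) * enorm x.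
  apply: lt_le_trans; rewrite subr_gt0 ltr_pdivrMr // /r mulrDr mulrCA divff ?gt_eqF //.
  lra.
rewrite /Q /S -mulrA mulr_suml -sumrB; apply: ler_sum => i _.
have [e1 [e2 e3]] := eax i; have e0 : 0 < enorm (x - a i) by lra.
have -> : q i / enorm (x - a i) * enorm x =
    q i + q i * ((enorm x - enorm (x - a i)) / enorm (x - a i)).
  by field; rewrite gt_eqF.
rewrite lerD2l lerNl -mulrN; apply: le_trans (ler_norm _) _.
rewrite normrM normrN ler_wpM2l // normrM normfV (gtr0_norm e0).
apply: ler_pM; rewrite ?invr_ge0 ?enorm_ge0 //.
  by rewrite ler_norml; lra.
by rewrite lef_pV2 ?posrE.
Qed.

Lemma potential_infty_small (R : realType) (d n : nat) (q : 'I_n -> R)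
    (a : 'I_n -> 'rV[R]_d) c :
  0 < c ->
  exists2 r, 0 < r & forall x, r <= `|x| ->
    (forall i, x != a i) /\ `|potential q a x| < c.
Proof.
move=> c0; set S := \sum_i `|q i|; have S0 : 0 <= S by exact: sumr_ge0.
set A := \sum_i `|a i|; have A0 : 0 <= A by exact: sumr_ge0.
have aA i : `|a i| <= A by rewrite /A (bigD1 i) //= lerDl sumr_ge0.
pose r := (S + 1) / c.
have r0 : 0 < r by rewrite divr_gt0 // ltr_wpDl.
exists (A + r); first by rewrite ltr_wpDl.
move=> x xr; have h i : r <= `|x - a i|.
  by have := lerB_dist x (a i); have := aA i; lra.
split => [i|]; first by rewrite -subr_eq0 -normr_gt0 (lt_le_trans r0).
apply: le_lt_trans (potential_abs_le q r0 h) _.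
by rewrite -/S ltr_pdivrMr // /r mulrC divfK ?gt_eqF // ltrDl.
Qed.

(** * The gradient field *)

Definition off_charges (R : realType) (d n : nat) (a : 'I_n -> 'rV[R]_d) :
  set 'rV[R]_d := [set x | forall i, x != a i].

(** The gradient of the potential written out, that is, the physical electric field with the
    opposite sign: the term of a positive charge points towards it. *)
Definition field (R : realType) (d n : nat) (q : 'I_n -> R)
    (a : 'I_n -> 'rV[R]_d) (x : 'rV[R]_d) : 'rV[R]_d :=
  \sum_(i < n) (- q i / enorm (x - a i) ^+ 3) *: (x - a i).

Lemma fieldN (R : realType) (d n : nat) (q : 'I_n -> R)
    (a : 'I_n -> 'rV[R]_d) x :
  field (fun i => - q i) a x = - field q a x.
Proof.
by rewrite /field -sumrN; apply: eq_bigr => i _; rewrite mulNr scaleNr.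
Qed.

Lemma dotE (R : realType) (d : nat) (u v : 'rV[R]_d) : dot u v = (u *m v^T) 0 0.
Proof. by rewrite mxE; apply: eq_bigr => j _; rewrite mxE. Qed.

Lemma is_derive_inv_enorm (R : realType) (d : nat) (x v : 'rV[R]_d) (t : R) :
  x + t *: v != 0 ->
  is_derive t 1 (fun s => (enorm (x + s *: v))^-1)
    (- dot (x + t *: v) v / enorm (x + t *: v) ^+ 3).
Proof.
move=> x0; have e0 := enorm_gt0 x0; have d0 := dot_gt0 x0.
(* Along the line the squared norm is a polynomial; it is positive at [t], so square root and
   inverse can be differentiated there. *)
pose P (s : R) := \sum_(j < d) (x 0 j + s * v 0 j) ^+ 2.
have PE s : P s = dot (x + s *: v) (x + s *: v).
  by apply: eq_bigr => j _; rewrite !mxE expr2.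
have dP : is_derive t 1 P (2 * dot (x + t *: v) v).
  have -> : P = \sum_(j < d) (cst (x 0 j) + id * cst (v 0 j)) ^+ 2.
    by apply/funext => s; rewrite /P fct_sumE.
  rewrite /dot mulr_sumr; apply: is_derive_sum => j.
  apply: is_derive_eq; rewrite !mxE /=.
  by rewrite /GRing.scale /= !fctE /=; ring.
have P0 : 0 < P t by rewrite PE.
have dS : is_derive t 1 (Num.sqrt \o P)
    ((2 * Num.sqrt (P t))^-1 * (2 * dot (x + t *: v) v)).
  by apply: is_derive1_comp; exact: is_derive1_sqrt.
have SE s : (Num.sqrt \o P) s = enorm (x + s *: v) by rewrite /= PE enormE.
have S0 : (Num.sqrt \o P) t != 0 by rewrite SE gt_eqF.
have -> : (fun s => (enorm (x + s *: v))^-1) = (fun s => ((Num.sqrt \o P) s)^-1).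
  by apply/funext => s; rewrite SE.
apply: DeriveDef; first exact: derivableV.
rewrite deriveV //; rewrite derive_val SE -/((Num.sqrt \o P) t) SE.
by rewrite /GRing.scale /=; field; rewrite gt_eqF.
Qed.

(** Stated at every time [t] of the line, as the mean value theorem on a segment requires; [t = 0]
    gives the directional derivatives. *)
Lemma is_derive_potential (R : realType) (d n : nat) (q : 'I_n -> R)
    (a : 'I_n -> 'rV[R]_d) (x v : 'rV[R]_d) (t : R) :
  off_charges a (x + t *: v) ->
  is_derive t 1 (fun s => potential q a (x + s *: v))
    (dot (field q a (x + t *: v)) v).
Proof.
move=> xa.
have -> : (fun s => potential q a (x + s *: v)) =
   \sum_(i < n) (cst (q i) * (fun s => (enorm (x - a i + s *: v))^-1)).
  apply/funext => s; rewrite fct_sumE; apply: eq_bigr => i _.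
  by rewrite (addrAC x).
have -> : dot (field q a (x + t *: v)) v =
    \sum_i (- q i / enorm (x + t *: v - a i) ^+ 3) * dot (x + t *: v - a i) v.
  rewrite dotE /field mulmx_suml summxE; apply: eq_bigr => i _.
  by rewrite -scalemxAl mxE dotE.
apply: is_derive_sum => i.
have xi : x - a i + t *: v != 0 by rewrite addrAC subr_eq0.
have dh := is_derive_inv_enorm xi.
apply: is_derive_eq; rewrite /GRing.scale /= mulr0 addr0 (addrAC x).
by rewrite !mulNr mulrN mulrAC mulrA.
Qed.

Lemma differentiable_potential (R : realType) (d n : nat) (q : 'I_n -> R)
    (a : 'I_n -> 'rV[R]_d) (x : 'rV[R]_d) :
  off_charges a x -> differentiable (potential q a) x.
Proof.
move=> xa.
have -> : potential q a = \sum_(i < n) (cst (q i) * (fun x => (enorm (x - a i))^-1)).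
  by apply/funext => s; rewrite fct_sumE.
apply: differentiable_sum => i; apply: differentiableM => //.
have x0 : x - a i != 0 by rewrite subr_eq0.
apply: (@differentiableV _ _ (fun x => enorm (x - a i))); last first.
  by rewrite gt_eqF // enorm_gt0.
pose P (x : 'rV[R]_d) := \sum_(j < d) (x - a i) 0 j ^+ 2.
have -> : (fun x => enorm (x - a i)) = Num.sqrt \o P by [].
apply: differentiable_comp.
  have -> : P = \sum_(j < d) ((fun x : 'rV[R]_d => x 0 j) - cst (a i 0 j)) ^+ 2.
    by apply/funext => y; rewrite fct_sumE; apply: eq_bigr => j _; rewrite !mxE.
  apply: differentiable_sum => j; apply: differentiableX.
  by apply: differentiableB => //; exact: differentiable_coord.
apply/derivable1_diffP.
have P0 : 0 < P x by have := enorm_gt0 x0; rewrite /enorm sqrtr_gt0.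
by have [] := is_derive1_sqrt P0.
Qed.

Lemma gradient_potential (R : realType) (d n : nat) (q : 'I_n -> R)
    (a : 'I_n -> 'rV[R]_d) (x : 'rV[R]_d) :
  off_charges a x -> gradient (potential q a) x = field q a x.
Proof.
move=> xa; apply/rowP => j; rewrite mxE.
have h : off_charges a (x + 0 *: delta_mx 0 j) by rewrite scale0r addr0.
case: (is_derive_potential q h) => _; rewrite scale0r addr0 => e.
transitivity (dot (field q a x) (delta_mx 0 j)).
  (* The derivative at 0 of the restriction to the line and the derivative at [x] along the basis
     vector are limits of the same quotients. *)
  rewrite -e /derive; do 2 f_equal; apply/funext => s /=.
  by rewrite scale0r !addr0 [s%:A]mulr1 (addrC x).
rewrite /dot (bigD1 j) //= big1 ?addr0 ?mxE ?eqxx ?mulr1 // => k kj.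
by rewrite mxE eqxx (negbTE kj) mulr0.
Qed.

Lemma potential_continuous (R : realType) (d n : nat) (q : 'I_n -> R)
    (a : 'I_n -> 'rV[R]_d) (x : 'rV[R]_d) :
  off_charges a x -> {for x, continuous (potential q a)}.
Proof. by move=> xa; apply/differentiable_continuous/differentiable_potential. Qed.

Lemma continuous_sumr (R : realType) (V : normedModType R)
    (T : topologicalType) (n : nat) (f : 'I_n -> T -> V) (x : T) :
  (forall i, {for x, continuous (f i)}) ->
  {for x, continuous (fun y => \sum_i f i y)}.
Proof. by move=> cf; apply: cvg_big => [|i _]; [exact: add_continuous|exact: cf]. Qed.

Lemma enorm_continuous (R : realType) (d : nat) : continuous (@enorm R d).
Proof.
move=> x; apply: (@continuous_comp _ _ _ (fun y : 'rV[R]_d => _) Num.sqrt);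
  last exact: sqrt_continuous.
apply: (@continuous_sumr _ R^o _ _ (fun j (y : 'rV[R]_d) => y 0 j ^+ 2)) => j.
apply: (@continuous_comp _ _ _ (fun y : 'rV[R]_d => y 0 j) (fun t => t ^+ 2)).
  exact: coord_continuous.
exact: exprn_continuous.
Qed.

Lemma field_continuous (R : realType) (d n : nat) (q : 'I_n -> R)
    (a : 'I_n -> 'rV[R]_d) (x : 'rV[R]_d) :
  off_charges a x -> {for x, continuous (field q a)}.
Proof.
move=> xa; apply: continuous_sumr => i.
have cx : {for x, continuous (fun y : 'rV[R]_d => y - a i)}.
  apply: (@continuousB _ _ _ id (cst (a i))); first by move=> A.
  exact: cst_continuous.
apply: continuousZ => //.
apply: (@continuousM R _ (cst (- q i)) (fun y : 'rV[R]_d => (enorm (y - a i) ^+ 3)^-1)).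
  exact: cst_continuous.
apply: continuousV; first by rewrite expf_neq0 // gt_eqF // enorm_gt0 // subr_eq0.
apply: (@continuous_comp _ _ _ (fun y : 'rV[R]_d => enorm (y - a i)) (fun t => t ^+ 3)).
  by apply: (continuous_comp cx); exact: enorm_continuous.
exact: exprn_continuous.
Qed.

(** * The ascent map *)

Lemma dotZr (R : realType) (d : nat) (c : R) (u v : 'rV[R]_d) :
  dot u (c *: v) = c * dot u v.
Proof.
by rewrite /dot mulr_sumr; apply: eq_bigr => j _; rewrite mxE mulrCA.
Qed.

Lemma potential_MVT (R : realType) (d n : nat) (q : 'I_n -> R)
    (a : 'I_n -> 'rV[R]_d) (x v : 'rV[R]_d) :
  (forall t, 0 <= t <= 1 -> off_charges a (x + t *: v)) ->
  exists2 t, 0 <= t <= 1 &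
    potential q a (x + v) - potential q a x = dot (field q a (x + t *: v)) v.
Proof.
move=> xa.
have [||t t01] := @MVT_segment R (fun s => potential q a (x + s *: v))
   (fun s => dot (field q a (x + s *: v)) v) 0 1 ler01.
- move=> t; rewrite in_itv /= => /andP[t0 t1].
  by apply: is_derive_potential; apply: xa; rewrite !ltW.
- apply: derivable_within_continuous => t; rewrite in_itv /= => t01.
  by have [] := is_derive_potential q (xa _ t01).
rewrite scale1r scale0r addr0 subr0 mulr1 => e; exists t => //.
Qed.

(* Requiring the field at any two points of the ball, rather than at x and at
   one other point, makes the reach below 1-Lipschitz. *)
Definition coherent (R : realType) (d n : nat) (q : 'I_n -> R)
    (a : 'I_n -> 'rV[R]_d) (x : 'rV[R]_d) (s : R) : Prop :=
  forall y z, `|y - x| < s -> `|z - x| < s ->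
    off_charges a y /\ 0 < dot (field q a y) (field q a z).

(** Capping at 1 bounds the set and later the step length; 0 always belongs to it, since the ball of
    radius 0 is empty. *)
Definition reach (R : realType) (d n : nat) (q : 'I_n -> R)
    (a : 'I_n -> 'rV[R]_d) (x : 'rV[R]_d) : R :=
  sup [set s | 0 <= s <= 1 /\ coherent q a x s].

(** Half the reach keeps the whole step strictly inside the coherent ball; the division gives the
    step exactly that sup-norm length when the field is nonzero. *)
Definition ascent (R : realType) (d n : nat) (q : 'I_n -> R)
    (a : 'I_n -> 'rV[R]_d) (x : 'rV[R]_d) : 'rV[R]_d :=
  x + (reach q a x / 2 / `|field q a x|) *: field q a x.

Lemma reach_has_sup (R : realType) (d n : nat) (q : 'I_n -> R)
    (a : 'I_n -> 'rV[R]_d) (x : 'rV[R]_d) :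
  has_sup [set s | 0 <= s <= 1 /\ coherent q a x s].
Proof.
split; last by exists 1 => s [/andP[]].
exists 0; split; first by rewrite lexx ler01.
by move=> y z; rewrite ltNge normr_ge0.
Qed.

Lemma reach_ge0 (R : realType) (d n : nat) (q : 'I_n -> R)
    (a : 'I_n -> 'rV[R]_d) (x : 'rV[R]_d) : 0 <= reach q a x.
Proof.
apply: sup_upper_bound; first exact: reach_has_sup.
split; first by rewrite lexx ler01.
by move=> y z; rewrite ltNge normr_ge0.
Qed.

Lemma reach_le1 (R : realType) (d n : nat) (q : 'I_n -> R)
    (a : 'I_n -> 'rV[R]_d) (x : 'rV[R]_d) : reach q a x <= 1.
Proof.
apply: ge_sup; first exact: (reach_has_sup q a x).1.
by move=> s [/andP[]].
Qed.

(** The supremum is attained because balls are open: two points strictly inside the limiting ball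
    are already inside a smaller coherent one. *)
Lemma reach_coherent (R : realType) (d n : nat) (q : 'I_n -> R)
    (a : 'I_n -> 'rV[R]_d) (x : 'rV[R]_d) : coherent q a x (reach q a x).
Proof.
move=> y z yr zr.
have m0 : 0 < reach q a x - Num.max `|y - x| `|z - x|.
  by rewrite subr_gt0 gt_max yr.
have [s [s01 gs]] := sup_adherent m0 (reach_has_sup q a x).
by rewrite subKr gt_max => /andP[h1 h2]; exact: gs.
Qed.

(** The ball of radius [s - |u - w|] about [w] lies in the ball of radius [s] about [u], and
    coherence passes to balls contained in a coherent one. *)
Lemma reach_lipschitz (R : realType) (d n : nat) (q : 'I_n -> R)
    (a : 'I_n -> 'rV[R]_d) (x y : 'rV[R]_d) :
  `|reach q a x - reach q a y| <= `|x - y|.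
Proof.
suff h (u w : 'rV[R]_d) : reach q a u <= reach q a w + `|u - w|.
  by rewrite ler_norml; have := h x y; have := h y x; rewrite (distrC y x); lra.
apply: ge_sup; first exact: (reach_has_sup q a u).1.
move=> s [/andP[s0 s1] gs]; have := reach_ge0 q a w.
have [sd|sd] := leP s `|u - w|; first lra.
move=> _; rewrite -lerBlDr; apply: sup_upper_bound; first exact: reach_has_sup.
split; first by have := normr_ge0 (u - w); lra.
move=> y' z' hy hz; apply: gs.
  by have := ler_distD w y' u; rewrite (distrC w u); lra.
by have := ler_distD w z' u; rewrite (distrC w u); lra.
Qed.

Lemma nbhs_rVP (R : realType) (d : nat) (x : 'rV[R]_d) (A : set 'rV[R]_d) :
  nbhs x A <-> exists2 e : R, 0 < e & forall y, `|y - x| < e -> A y.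
Proof.
have h : nbhs x A <-> nbhs_ball_ (ball_ Num.Def.normr) x A := @nbhs_normP R 'rV[R]_d x A.
apply: (iff_trans h).
split=> -[e e0 eA]; exists e => // y xy; apply: eA; move: xy;
  by rewrite /ball_ /= distrC.
Qed.

Lemma reach_continuous (R : realType) (d n : nat) (q : 'I_n -> R)
    (a : 'I_n -> 'rV[R]_d) : continuous (reach q a).
Proof.
move=> x A /nbhs_normP[e e0 eA]; apply/nbhs_rVP; exists e => // y yx.
apply: eA; apply: le_lt_trans (reach_lipschitz _ _ _ _) _.
by rewrite distrC.
Qed.

Lemma dot_continuous (R : realType) (d : nat) (p : 'rV[R]_d * 'rV[R]_d) :
  {for p, continuous (fun p : 'rV[R]_d * 'rV[R]_d => dot p.1 p.2)}.
Proof.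
apply: (@continuous_sumr _ R^o _ _
  (fun j (p : 'rV[R]_d * 'rV[R]_d) => p.1 0 j * p.2 0 j)) => j.
apply: (@continuousM R _ (fun p : 'rV[R]_d * 'rV[R]_d => p.1 0 j)
  (fun p : 'rV[R]_d * 'rV[R]_d => p.2 0 j)).
  apply: (@continuous_comp _ _ _ fst (fun u : 'rV[R]_d => u 0 j)).
    exact: cvg_fst.
  exact: coord_continuous.
apply: (@continuous_comp _ _ _ snd (fun u : 'rV[R]_d => u 0 j)).
  exact: cvg_snd.
exact: coord_continuous.
Qed.

Lemma off_charges_open (R : realType) (d n : nat) (a : 'I_n -> 'rV[R]_d) :
  open (off_charges a).
Proof.
rewrite openE => x xa.
have [||r r0 h] := @uniform_radius R 'I_n (fun i r => r <= `|x - a i|).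
- by move=> i r s; exact: le_trans.
- by move=> i; exists `|x - a i| => //; rewrite normr_gt0 subr_eq0.
apply/nbhs_rVP; exists r => // y yr i; apply/eqP => ya.
by have := h i; rewrite -ya distrC leNgt yr.
Qed.

(** The inner product of a nonzero field value with itself is positive, and stays positive when both
    arguments vary slightly, by continuity. *)
Lemma reach_gt0 (R : realType) (d n : nat) (q : 'I_n -> R)
    (a : 'I_n -> 'rV[R]_d) (x : 'rV[R]_d) :
  off_charges a x -> field q a x != 0 -> 0 < reach q a x.
Proof.
move=> xa fx0.
have fc := @field_continuous _ _ _ q _ _ xa.
have : nbhs (field q a x, field q a x) [set p | 0 < dot p.1 p.2].
  apply: (@dot_continuous R d (field q a x, field q a x) [set t | 0 < t]).
  by apply: open_nbhs_nbhs; split; [exact: open_gt|exact: dot_gt0].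
case=> -[A B] /= [/fc/nbhs_rVP[r1 r10 h1] /fc/nbhs_rVP[r2 r20 h2]] hAB.
have /nbhs_rVP[r3 r30 h3] : nbhs x (off_charges a).
  by apply: open_nbhs_nbhs; split => //; exact: off_charges_open.
pose s := Num.min (Num.min 1 r1) (Num.min r2 r3).
have s0 : 0 < s by rewrite !lt_min ltr01 r10 r20.
apply: lt_le_trans s0 _; apply: sup_upper_bound; first exact: reach_has_sup.
split; first by rewrite !ge_min lexx andbT ltW // !lt_min ltr01 r10 r20.
move=> y z; rewrite !lt_min => /andP[/andP[_ y1] /andP[_ y3]].
move=> /andP[_ /andP[z2 _]]; split; first exact: h3.
by apply: (hAB (field q a y, field q a z)); split; [exact: h1|exact: h2].
Qed.

Lemma ascent_dist (R : realType) (d n : nat) (q : 'I_n -> R)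
    (a : 'I_n -> 'rV[R]_d) (x : 'rV[R]_d) :
  field q a x != 0 -> `|ascent q a x - x| = reach q a x / 2.
Proof.
move=> fx; rewrite /ascent addrC addKr normrZ normrM normfV normr_id.
by rewrite divfK ?normr_eq0 // ger0_norm // divr_ge0 // reach_ge0.
Qed.

(** The segment of the step lies in the coherent ball, so the field at the mean value point has
    positive inner product with the field at [x], the direction of the step. *)
Lemma ascent_spec (R : realType) (d n : nat) (q : 'I_n -> R)
    (a : 'I_n -> 'rV[R]_d) (x : 'rV[R]_d) :
  off_charges a x -> field q a x != 0 ->
  off_charges a (ascent q a x) /\ potential q a x < potential q a (ascent q a x).
Proof.
move=> xa fx; have r0 := reach_gt0 xa fx; have dT := ascent_dist fx.
have near t : 0 <= t <= 1 -> `|x + t *: (ascent q a x - x) - x| < reach q a x.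
  move=> /andP[t0 t1]; rewrite addrC addKr normrZ dT ger0_norm //.
  by nra.
have near1 : `|ascent q a x - x| < reach q a x by rewrite dT; lra.
have near0 : `|x - x| < reach q a x by rewrite subrr normr0.
split; first exact: (reach_coherent near1 near1).1.
have [t t01|t t01] := @potential_MVT _ _ _ q a x (ascent q a x - x).
  exact: (reach_coherent (near t t01) near0).1.
rewrite (addrC x (_ - x)) subrK -subr_gt0 => ->.
have [_ h] := reach_coherent (near t t01) near0.
have e : ascent q a x - x = (reach q a x / 2 / `|field q a x|) *: field q a x.
  by rewrite /ascent (addrC x) addrK.
rewrite [X in dot _ X]e dotZr.
by rewrite mulr_gt0 // !divr_gt0 // normr_gt0.
Qed.

Lemma ascent_continuous (R : realType) (d n : nat) (q : 'I_n -> R)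
    (a : 'I_n -> 'rV[R]_d) (x : 'rV[R]_d) :
  off_charges a x -> field q a x != 0 -> {for x, continuous (ascent q a)}.
Proof.
move=> xa fx; have fc := @field_continuous _ _ _ q _ _ xa.
apply: (@continuousD _ _ _ id
  (fun y => (reach q a y / 2 / `|field q a y|) *: field q a y)); first by move=> A.
apply: continuousZ => //.
apply: (@continuousM R _ (fun y => reach q a y / 2) (fun y => `|field q a y|^-1)).
  apply: (@continuousM R _ (reach q a) (cst 2^-1)); last exact: cst_continuous.
  exact: reach_continuous.
apply: continuousV; first by rewrite normr_eq0.
by apply: (continuous_comp fc); exact: norm_continuous.
Qed.

(** * Connectedness off the charges *)

(** On the interval from 0 to 1 the preimage of [U] is nonempty, open, and closed as the complement
    of that of [V]; connectedness makes it everything. *)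
Lemma segment_same_side (R : realType) (d : nat) (U V : set 'rV[R]_d)
    (p v : 'rV[R]_d) :
  open U -> open V ->
  (forall t, 0 <= t <= 1 -> U (p + t *: v) \/ V (p + t *: v)) ->
  (forall t, 0 <= t <= 1 -> U (p + t *: v) -> V (p + t *: v) -> False) ->
  U p -> U (p + v).
Proof.
move=> oU oV cover disj Up; pose g (t : R) := p + t *: v.
have cg : continuous g.
  move=> t; apply: (@continuousD _ _ _ (cst p) (fun t : R => t *: v)).
    exact: cst_continuous.
  apply: (@continuousZ _ _ _ (@id R) (cst v)); last exact: cst_continuous.
  by move=> A.
have e : `[0, 1] `&` g @^-1` U = `[0, 1]%classic.
  apply: segment_connected.
  - by exists 0; split; rewrite /= ?in_itv /= ?lexx ?ler01 // /g scale0r addr0.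
  - by exists (g @^-1` U) => //; move/continuousP : cg; apply.
  - exists (~` (g @^-1` V)).
      by apply: open_closedC; move/continuousP : cg; apply.
    apply/seteqP; split => t /= [t01 h]; split => //;
      move: (t01); rewrite in_itv /= => t01'.
      by move=> Vt; exact: (disj _ t01' h).
    by case: (cover _ t01').
have : (`[0, 1] `&` g @^-1` U) 1 by rewrite e /= in_itv /= ler01 lexx.
by case=> _; rewrite /= /g scale1r.
Qed.

(** For independent [g] and [w], lines through [p] of distinct slopes meet only at [p], so a charge
    other than [p] lies on at most one of them. *)
Lemma blocked_ray_inj (R : realType) (d n : nat) (a : 'I_n -> 'rV[R]_d)
    (p g w : 'rV[R]_d) (i : 'I_n) (s s' t t' : R) :
  (forall u u' : R, u *: g = u' *: w -> u = 0 /\ u' = 0) ->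
  p != a i ->
  a i = p + t *: (g + s *: w) -> a i = p + t' *: (g + s' *: w) -> s = s'.
Proof.
move=> gw pa e e'.
have t0 : t != 0.
  by apply: contraNneq pa => t0; rewrite e t0 scale0r addr0.
have : t *: (g + s *: w) = t' *: (g + s' *: w).
  by apply: (addrI p); rewrite -e -e'.
rewrite !scalerDr !scalerA => h.
have /gw[h1 h2] : (t - t') *: g = (t' * s' - t * s) *: w.
  by apply/rowP => j; move/rowP/(_ j): h; rewrite !mxE; lra.
have tt : t = t' by lra.
apply: (mulfI t0); rewrite {2}tt; lra.
Qed.

(** A pigeonhole argument: the broken line from [p] to [r] bends at a point above the midpoint, and
    each charge rules out at most one height per leg. *)
Lemma detour (R : realType) (d n : nat) (a : 'I_n -> 'rV[R]_d)
    (p r : 'rV[R]_d) :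
  (2 <= d)%N -> p != r -> off_charges a p -> off_charges a r ->
  exists2 m,
    forall t, 0 <= t <= 1 -> off_charges a (p + t *: (m - p)) &
    forall t, 0 <= t <= 1 -> off_charges a (m + t *: (r - m)).
Proof.
move=> d2 pr pa ra.
pose g := 2^-1 *: (r - p).
(* A basis vector along an axis [k] other than some [j] with [g 0 j] nonzero is independent of [g];
   this is where [d >= 2] enters. *)
have [k gw] : exists k, forall u u' : R,
    u *: g = u' *: delta_mx 0 k -> u = 0 /\ u' = 0.
  have /existsP[j gj] : [exists j, g 0 j != 0].
    apply: contraNT pr => /existsPn h; rewrite eq_sym -subr_eq0.
    have /eqP : g = 0 by apply/rowP => j; have := h j; rewrite negbK [RHS]mxE => /eqP.
    by rewrite /g scaler_eq0 invr_eq0 pnatr_eq0.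
  have [k kj] : exists k : 'I_d, k != j.
    have [j0|j0] := eqVneq (nat_of_ord j) 0%N.
      by exists (Ordinal d2); rewrite -val_eqE /= j0.
    by exists (Ordinal (ltnW d2)); rewrite -val_eqE /= eq_sym.
  exists k => u u' /rowP e.
  have u0 : u = 0.
    have := e j; rewrite [LHS]mxE [RHS]mxE [delta_mx _ _ _ _]mxE eqxx /=.
    rewrite eq_sym (negbTE kj) mulr0 => /eqP.
    by rewrite mulf_eq0 (negbTE gj) orbF => /eqP.
  by split => //; have := e k; rewrite !mxE !eqxx u0 mul0r mulr1.
set w := delta_mx 0 k in gw.
have gw' (u u' : R) : u *: (- g) = u' *: w -> u = 0 /\ u' = 0.
  by rewrite scalerN -scaleNr => /gw[]; lra.
(* There are [2 n + 1] candidate heights against [2 n] obstacles, namely a charge together with a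
   leg; [true] marks the leg from [p], [false] the one from [r]. *)
pose bad (s : 'I_(n + n).+1) (c : bool * 'I_n) := exists t : R,
  if c.1 then a c.2 = p + t *: (g + (s : nat)%:R *: w)
  else a c.2 = r + t *: (- g + (s : nat)%:R *: w).
have [s good] : exists s, forall c, ~ bad s c.
  apply: contrapT => /forallNP h.
  have {}h s : exists c, bad s c.
    by have := h s; rewrite -existsNP => -[c /contrapT]; exists c.
  have [c bc] := choice h.
  have : injective c.
    move=> s s' cs; have := bc s; have := bc s'; rewrite -cs /bad.
    case: (c s) => -[] i /= [t' e'] [t e]; apply: ord_inj; apply/eqP.
      by rewrite -(eqr_nat R); apply/eqP; exact: (blocked_ray_inj gw (pa i) e e').
    by rewrite -(eqr_nat R); apply/eqP; exact: (blocked_ray_inj gw' (ra i) e e').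
  move=> /leq_card; rewrite card_ord card_prod card_bool card_ord.
  by rewrite mul2n -addnn ltnn.
exists (p + (g + (s : nat)%:R *: w)) => t t01 i; apply/eqP => e.
  by apply: (good (true, i)); exists t; rewrite -e /= addrAC subrr add0r.
(* The second leg is travelled towards [r], whereas [bad] parametrizes it from [r]. *)
apply: (good (false, i)); exists (1 - t); rewrite -e /=.
have -> : r = p + 2 *: g by rewrite scalerA mulfV // scale1r addrC subrK.
by apply/rowP => j; rewrite !mxE; lra.
Qed.

(** Two segments avoiding the charges join any two points, and membership in [U] propagates along
    each. *)
Lemma off_charges_connected (R : realType) (d n : nat) (a : 'I_n -> 'rV[R]_d)
    (U V : set 'rV[R]_d) :
  (2 <= d)%N -> open U -> open V ->
  (forall x, off_charges a x -> U x \/ V x) ->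
  (forall x, off_charges a x -> U x -> V x -> False) ->
  (exists2 p, off_charges a p & U p) -> (exists2 r, off_charges a r & V r) ->
  False.
Proof.
move=> d2 oU oV cover disj [p pa Up] [r ra Vr].
have pr : p != r by apply/eqP => e; apply: (disj p) => //; rewrite e.
have [m pm mr] := detour d2 pr pa ra.
have Um : U m.
  rewrite -[m](subrKC p); apply: (segment_same_side oU oV) => // t t01.
    exact: cover (pm _ t01).
  exact: disj (pm _ t01).
apply: (disj r) => //.
rewrite -[r](subrKC m); apply: (segment_same_side oU oV) => // t t01.
  exact: cover (mr _ t01).
exact: disj (mr _ t01).
Qed.

Lemma iter_invariant (T : Type) (X A : set T) (f : T -> T) k x :
  (forall y, X y -> X (f y)) -> (forall y, X y -> A y -> A (f y)) ->
  X x -> A x -> X (iter k f x) /\ A (iter k f x).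
Proof.
move=> fX fA Xx Ax; elim: k => //= k [Xk Ak]; split; [exact: fX|exact: fA].
Qed.

(** The points whose orbit enters [A], and those whose orbit enters [B], form open sets since
    iterates are continuous. They are disjoint: an orbit in [A] at time [k] and in [B] at time [l]
    is in both at time [k + l]. This contradicts connectedness. *)
Lemma disjoint_basins (R : realType) (d n : nat) (a : 'I_n -> 'rV[R]_d)
    (f : 'rV[R]_d -> 'rV[R]_d) (A B : set 'rV[R]_d) :
  (2 <= d)%N ->
  (forall x, off_charges a x -> off_charges a (f x)) ->
  (forall x, off_charges a x -> {for x, continuous f}) ->
  open A -> open B ->
  (forall x, off_charges a x -> A x -> A (f x)) ->
  (forall x, off_charges a x -> B x -> B (f x)) ->
  (forall x, off_charges a x -> A x -> B x -> False) ->
  (exists2 p, off_charges a p & A p) -> (exists2 r, off_charges a r & B r) ->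
  (forall x, off_charges a x -> exists k, A (iter k f x) \/ B (iter k f x)) ->
  False.
Proof.
move=> d2 fX fc oA oB fA fB disj [p pa Ap] [r ra Br] cover.
have iX k x : off_charges a x -> off_charges a (iter k f x).
  by move=> xa; elim: k => //= k; exact: fX.
have ic k x : off_charges a x -> {for x, continuous (iter k f)}.
  move=> xa; elim: k => [|k ih]; first by move=> C.
  exact: (continuous_comp ih (fc _ (iX k x xa))).
have oX := @off_charges_open _ _ _ a.
have basin_open C : open C ->
    open [set x | off_charges a x /\ exists k, C (iter k f x)].
  move=> oC; rewrite openE => x [xa [k Ck]]; rewrite /interior.
  apply: filterS2 (_ : nbhs x (off_charges a)) (_ : nbhs x (iter k f @^-1` C)).
  - by move=> y ya Cy; split => //; exists k.
  - exact: open_nbhs_nbhs.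
  - by apply: ic => //; exact: open_nbhs_nbhs.
apply: (off_charges_connected d2 (basin_open A oA) (basin_open B oB)).
- by move=> x xa; have [k [h|h]] := cover x xa; [left|right]; split => //; exists k.
- move=> x xa [_ [k Ak]] [_ [l Bl]].
  have [Xl Al] := iter_invariant l fX fA (iX k x xa) Ak.
  have [_ Bk] := iter_invariant k fX fB (iX l x xa) Bl.
  by apply: (disj _ Xl Al); rewrite -iterD addnC iterD.
- by exists p => //; split => //; exists 0%N.
- by exists r => //; split => //; exists 0%N.
Qed.

(** * Orbits of the ascent map *)

Lemma iter_ascent (R : realType) (d n : nat) (q : 'I_n -> R)
    (a : 'I_n -> 'rV[R]_d) (x : 'rV[R]_d) k :
  (forall x, off_charges a x -> field q a x != 0) ->
  off_charges a x ->
  off_charges a (iter k (ascent q a) x) /\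
  potential q a x <= potential q a (iter k (ascent q a) x).
Proof.
move=> nz xa; elim: k => //= k [ka ih].
have [Ta Tf] := ascent_spec ka (nz _ ka); split => //.
exact: le_trans ih (ltW Tf).
Qed.

Lemma dist_continuous (R : realType) (d : nat) (c : 'rV[R]_d) :
  continuous (fun x : 'rV[R]_d => `|x - c|).
Proof.
move=> x; apply: (@continuous_comp _ _ _ (fun x : 'rV[R]_d => x - c) Num.norm);
  last exact: norm_continuous.
apply: (@continuousB _ _ _ id (cst c)); first by move=> A.
exact: cst_continuous.
Qed.

Lemma closed_dist_ge (R : realType) (d : nat) (c : 'rV[R]_d) (r : R) :
  closed [set x : 'rV[R]_d | r <= `|x - c|].
Proof.
have /continuous_closedP h := @dist_continuous R d c.
exact (h [set t | r <= t] (@closed_ge R r)).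
Qed.

Lemma closed_normr_le (R : realType) (d : nat) (r : R) :
  closed [set x : 'rV[R]_d | `|x| <= r].
Proof.
have /continuous_closedP h : continuous (Num.norm : 'rV[R]_d -> R).
  exact: norm_continuous.
exact (h [set t | t <= r] (@closed_le R r)).
Qed.

Lemma compact_normr_le (R : realType) (d : nat) (r : R) (A : set 'rV[R]_d) :
  closed A -> compact ([set x : 'rV[R]_d | `|x| <= r] `&` A).
Proof.
move=> cA; apply: bounded_closed_compact.
  exists r; split; first exact: num_real.
  by move=> M rM x [xr _]; exact: le_trans xr (ltW rM).
by apply: closedI => //; exact: closed_normr_le.
Qed.

(** Otherwise the orbit stays in a compact set off the charges, where the gain of one step has a
    positive minimum, so the potential grows at least linearly. *)
Lemma bounded_orbit_high (R : realType) (d n : nat) (q : 'I_n -> R)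
    (a : 'I_n -> 'rV[R]_d) (x : 'rV[R]_d) (r M : R) :
  injective a -> (forall i, q i != 0) ->
  (forall x, off_charges a x -> field q a x != 0) ->
  off_charges a x ->
  (forall k, `|iter k (ascent q a) x| <= r) ->
  exists k, M < potential q a (iter k (ascent q a) x).
Proof.
move=> inja q0 nz xa bnd; apply: contrapT => /forallNP h.
have [s s0 away] := @bounded_potential_away _ _ _ q a (potential q a x) M inja q0.
pose K := [set y : 'rV[R]_d | `|y| <= r] `&` \bigcap_i [set y | s <= `|y - a i|].
have K0 k : K (iter k (ascent q a) x).
  have [ka kf] := iter_ascent k nz xa; split; first exact: bnd.
  move=> i _; apply: away => //; rewrite kf /= leNgt; apply/negP; exact: h.
have KX y : K y -> off_charges a y.
  move=> [_ ya] i; rewrite -subr_eq0 -normr_gt0; apply: lt_le_trans s0 _.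
  exact: ya.
pose gain y := potential q a (ascent q a y) - potential q a y.
have [||| c] := @EVT_min_rV R d gain K.
- by exists x; exact: (K0 0%N).
- apply: compact_normr_le; apply: closed_bigI => i _; exact: closed_dist_ge.
- apply: continuous_in_subspaceT => y; rewrite inE => /KX ya.
  have [Ta _] := ascent_spec ya (nz _ ya).
  apply: (@continuousB R R^o _ (potential q a \o ascent q a) (potential q a)).
    apply: (@continuous_comp _ _ _ (ascent q a) (potential q a)).
      exact: ascent_continuous ya (nz _ ya).
    exact: potential_continuous.
  exact: potential_continuous.
rewrite inE => /KX ca cmin.
have g0 : 0 < gain c.
  by rewrite subr_gt0; have [] := ascent_spec ca (nz _ ca).
have grow k : potential q a x + k%:R * gain c <= potential q a (iter k (ascent q a) x).
  elim: k => [|k ih]; first by rewrite mul0r addr0.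
  have := cmin (iter k (ascent q a) x); rewrite inE => /(_ (K0 k)).
  rewrite {2}/gain /= => gk; rewrite -natr1 mulrDl mul1r; lra.
have b0 : 0 <= `|M - potential q a x| / gain c by rewrite divr_ge0 // ltW.
have := archi_boundP b0; set N := Num.Def.archi_bound _.
rewrite ltr_pdivrMr // => hN; apply: (h N).
have := grow N; have := ler_norm (M - potential q a x); lra.
Qed.

(** A coherent ball contains no charge. Hence a step covers at most half the distance to any
    charge. *)
Lemma reach_le_dist (R : realType) (d n : nat) (q : 'I_n -> R)
    (a : 'I_n -> 'rV[R]_d) (x : 'rV[R]_d) i : reach q a x <= `|x - a i|.
Proof.
rewrite leNgt distrC; apply/negP => h.
by have [/(_ i)/eqP] := reach_coherent h h.
Qed.

Lemma exists_normr (R : realType) (d : nat) (s : R) : (0 < d)%N -> 0 <= s ->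
  exists x : 'rV[R]_d, `|x| = s.
Proof.
move=> d0 s0; exists (const_mx s); apply/le_anti/andP; split.
  by apply: normr_le_coord => // j; rewrite mxE ger0_norm.
have := normr_coord (const_mx s : 'rV[R]_d) (Ordinal d0).
by rewrite mxE ger0_norm.
Qed.

Lemma off_charges_near (R : realType) (d n : nat) (a : 'I_n -> 'rV[R]_d)
    (i : 'I_n) (r : R) :
  (0 < d)%N -> injective a -> 0 < r ->
  exists2 x, off_charges a x & `|x - a i| < r.
Proof.
move=> d0 inja r0; have [t t0 sep] := separation inja.
(* Smaller than [r] and than the separation, so the sphere of radius [s] about [a i] meets no
   charge. *)
pose s := Num.min r t / 2.
have m0 : 0 < Num.min r t by rewrite lt_min r0.
have mr : Num.min r t <= r by rewrite ge_min lexx.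
have mt : Num.min r t <= t by rewrite ge_min lexx orbT.
have s0 : 0 < s by rewrite divr_gt0.
have [v vs] := @exists_normr R d s d0 (ltW s0).
exists (a i + v); last by rewrite addrC addKr vs /s; lra.
move=> k; apply/eqP => e.
have [ik|ik] := eqVneq i k.
  move: e; rewrite ik -{2}[a k]addr0 => /addrI v0.
  by move: vs; rewrite v0 normr0; lra.
have := sep _ _ ik; rewrite -e opprD addrA subrr add0r normrN vs /s; lra.
Qed.

(* The sink E stands for the point at infinity; it is empty when the potential
   is positive there. *)
Lemma two_sinks (R : realType) (d n : nat) (q : 'I_n -> R)
    (a : 'I_n -> 'rV[R]_d) (i : 'I_n) (E : set 'rV[R]_d) :
  (2 <= d)%N -> injective a -> (forall i, q i != 0) ->
  (forall x, off_charges a x -> field q a x != 0) ->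
  0 < q i ->
  open E ->
  (forall x, off_charges a x -> E x -> E (ascent q a x)) ->
  (forall x, E x -> potential q a x < 0) ->
  (forall x, off_charges a x ->
    (exists k, E (iter k (ascent q a) x)) \/
    (exists l r, forall k, `|iter (k + l) (ascent q a) x| <= r)) ->
  (exists2 j, j != i & 0 < q j) \/ (exists2 x, off_charges a x & E x) ->
  False.
Proof.
move=> d2 inja q0 nz qi oE TE Eneg orbit other.
have d0 : (0 < d)%N by exact: ltnW.
have [t t0 sep] := separation inja.
(* Balls of radii [2 r] and [r] about distinct charges are then disjoint; the factor 2 leaves room
   for one step. *)
pose r := t / 4; have r0 : 0 < r by rewrite divr_gt0.
pose M := (\sum_k `|q k|) / r.
have M0 : 0 <= M by rewrite divr_ge0 ?sumr_ge0 // ltW.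
have high x : M < potential q a x -> exists2 k, 0 < q k & `|x - a k| < r.
  exact: potential_gt_near_pos.
have near_unique k l x : `|x - a k| < 2 * r -> `|x - a l| < r -> k = l.
  move=> xk xl; apply/eqP; apply: contraT => /sep.
  by have := ler_distD x (a k) (a l); rewrite (distrC (a k) x) /r in xk xl *; lra.
(* After the step the point is still high, hence within [r] of some positive charge; having moved at
   most half its distance to [a k], it is within [2 r] of [a k], so that charge is [k]. *)
have step x k : off_charges a x -> M < potential q a x -> `|x - a k| < r ->
    `|ascent q a x - a k| < r.
  move=> xa xM xk; have [_ Tf] := ascent_spec xa (nz _ xa).
  have [l ql Tl] := high _ (lt_trans xM Tf).
  suff kl : k = l by rewrite kl.
  apply: near_unique Tl.
  have := ler_distD x (ascent q a x) (a k); rewrite ascent_dist ?nz //.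
  by have := reach_le_dist q a x k; lra.
pose H := [set x | off_charges a x /\ M < potential q a x].
have oH : open H.
  rewrite openE => x [xa xM]; rewrite /interior.
  apply: filterS2 (_ : nbhs x (off_charges a))
    (_ : nbhs x (potential q a @^-1` [set t | M < t])).
  - by move=> y ya yM; split.
  - by apply: open_nbhs_nbhs; split => //; exact: off_charges_open.
  - apply: (potential_continuous xa); apply: open_nbhs_nbhs; split => //.
have TH x : H x -> H (ascent q a x).
  move=> [xa xM]; have [Ta Tf] := ascent_spec xa (nz _ xa).
  by split => //; exact: lt_trans Tf.
have oball (P : set R) : open P -> open [set x | P `|x - a i|].
  move=> oP; have /continuousP h := @dist_continuous R d (a i).
  exact: (h P oP).
(* One sink is the high region near [a i]; the other joins the high region near the remaining
   positive charges with [E], where the potential is negative and so below [M]. *)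
apply: (@disjoint_basins R d n a (ascent q a)
  (H `&` [set x | `|x - a i| < r])
  ((H `&` [set x | r < `|x - a i|]) `|` E)) => //.
- by move=> x xa; have [] := ascent_spec xa (nz _ xa).
- by move=> x xa; exact: ascent_continuous xa (nz _ xa).
- by apply: openI => //; apply: (oball [set s | s < r]); exact: open_lt.
- apply: openU => //; apply: openI => //.
  by apply: (oball [set s | r < s]); exact: open_gt.
- by move=> x xa [Hx xi]; split; [exact: TH|exact: step Hx.1 Hx.2 xi].
- move=> x xa [[Hx xi]|Ex]; [left|right; exact: TE].
  split; first exact: TH.
  have [k qk xk] := high _ Hx.2; have Tk := step _ _ Hx.1 Hx.2 xk.
  rewrite /= ltNge; apply/negP => Ti.
  have ik : i = k by apply: near_unique Tk; lra.
  by move: xi; rewrite /= ik; lra.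
- move=> x xa [[_ xM] xi] [[_ xi']|/Eneg]; last lra.
  by move: xi xi' => /=; lra.
- have [s s0 hs] := potential_near_pos M inja qi.
  have [|x xa] := @off_charges_near R d n a i (Num.min r s) d0 inja.
    by rewrite lt_min r0.
  by rewrite lt_min => /andP[xr xs]; exists x => //; split => //; split => //; exact: hs.
- case: other => [[j ji qj]|[x xa Ex]]; last by exists x => //; right.
  have [s s0 hs] := potential_near_pos M inja qj.
  have [|x xa] := @off_charges_near R d n a j (Num.min r s) d0 inja.
    by rewrite lt_min r0.
  rewrite lt_min => /andP[xr xs]; exists x => //; left.
  split; first by split => //; exact: hs.
  rewrite /= ltNge; apply/negP => xi.
  have ij : i = j by apply: near_unique xr; lra.
  by move: ji; rewrite ij eqxx.
- move=> x xa; have [[k Ek]|[l [b hb]]] := orbit x xa.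
    by exists k; right; right.
  have [la _] := iter_ascent l nz xa.
  have [|k] := @bounded_orbit_high _ _ _ _ _ _ b M inja q0 nz la.
    by move=> k; rewrite -iterD.
  rewrite -iterD => kM; have [ka _] := iter_ascent (k + l) nz xa.
  exists (k + l)%N; have [m qm xm] := high _ kM.
  have [im|im] := eqVneq i m; first by left; split => //; rewrite /= im.
  right; left; split => //; rewrite /= ltNge; apply/negP => xi.
  have im' : i = m by apply: near_unique xm; lra.
  by move: im; rewrite im' eqxx.
Qed.

(** Without a zero, [two_sinks] applies. For negative total charge its [E] is a neighbourhood of
    infinity cut off by a shell; for positive total charge orbits are bounded and a second positive
    charge is the other sink. *)
Lemma has_field_zero (R : realType) (d n : nat) (q : 'I_n -> R)
    (a : 'I_n -> 'rV[R]_d) (i : 'I_n) :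
  (2 <= d)%N -> injective a -> (forall i, q i != 0) ->
  0 < q i -> \sum_k q k != 0 ->
  (exists2 j, j != i & 0 < q j) \/ \sum_k q k < 0 ->
  exists2 x, off_charges a x & field q a x = 0.
Proof.
move=> d2 inja q0 qi Q0 other; apply: contrapT => nex.
have nz x : off_charges a x -> field q a x != 0.
  by move=> xa; apply/eqP => fx; apply: nex; exists x.
have [Q|Q|/eqP] := ltgtP (\sum_k q k) 0; last by rewrite (negbTE Q0).
- have QN : 0 < \sum_k - q k by rewrite sumrN oppr_gt0.
  have [r1 r10 neg1] := potential_infty_pos a QN.
  have [r2 r20 off2] := @potential_infty_small _ _ _ q a 1 ltr01.
  pose r := Num.max r1 r2.
  have far x : r <= `|x| -> off_charges a x /\ potential q a x < 0.
    rewrite ge_max => /andP[x1 x2]; have [xa _] := off2 x x2; split => //.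
    by rewrite -oppr_gt0 -potentialN; exact: neg1.
  (* A shell of width 1, which no step can jump over because the reach is at most 1. *)
  pose K : set 'rV[R]_d := [set x | `|x| <= r + 1] `&` [set x | r <= `|x - 0|].
  have r0 : 0 < r by rewrite lt_max r10.
  have [||| c] := @EVT_max_rV R d (potential q a) K.
  + have [x xr] := @exists_normr R d r (ltnW d2) (ltW r0).
    by exists x; split; rewrite /= ?subr0 xr ?lexx // lerDl.
  + by apply: compact_normr_le; exact: closed_dist_ge.
  + apply: continuous_in_subspaceT => x; rewrite inE => -[_ /=].
    by rewrite subr0 => /far[xa _]; exact: potential_continuous.
  rewrite inE => -[_ /=]; rewrite subr0 => /far[_ c0] cmax.
  pose e := - potential q a c; have e0 : 0 < e by rewrite oppr_gt0.
  have shell x : r <= `|x| -> `|x| <= r + 1 -> potential q a x <= - e.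
    by move=> x1 x2; rewrite opprK; apply: cmax; rewrite inE; split; rewrite /= ?subr0.
  have [s s0 small] := @potential_infty_small _ _ _ q a e e0.
  have higher x : s <= `|x| -> - e < potential q a x.
    by move=> /small[_]; rewrite ltr_norml => /andP[].
  (* Outside the shell and above the maximum [- e] of the potential on it: an ascending orbit cannot
     come back through the shell. *)
  pose E : set 'rV[R]_d :=
    [set x | off_charges a x /\ r + 1 < `|x| /\ - e < potential q a x].
  apply: (@two_sinks R d n q a i E) => //.
  + rewrite openE => x [xa [xr xe]]; rewrite /interior.
    have nX : nbhs x (off_charges a).
      by apply: open_nbhs_nbhs; split => //; exact: off_charges_open.
    have nr : nbhs x (Num.norm @^-1` [set t | r + 1 < t]).
      apply: (@norm_continuous R 'rV[R]_d x); apply: open_nbhs_nbhs.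
      by split => //; exact: open_gt.
    have ne : nbhs x (potential q a @^-1` [set t | - e < t]).
      apply: (potential_continuous xa); apply: open_nbhs_nbhs; split => //.
    by apply: filterS3 nX nr ne => y ya yr ye.
  + move=> x xa [_ [xr xe]]; have [Ta Tf] := ascent_spec xa (nz _ xa).
    have Te := lt_trans xe Tf; split => //; split => //.
    rewrite ltNge; apply/negP => Tr.
    (* From beyond [r + 1] a step of length at most one half could only return into the shell. *)
    have : potential q a (ascent q a x) <= - e.
      apply: shell => //; have := lerB_dist x (ascent q a x).
      rewrite distrC ascent_dist ?nz //; have := reach_le1 q a x; lra.
    by rewrite leNgt Te.
  + by move=> x [_ [xr _]]; have [] := far x _; first by lra.
  + move=> x xa; have [[k Ek]|/forallNP noE] :=
      pselect (exists k, E (iter k (ascent q a) x)).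
      by left; exists k.
    (* Every point beyond this radius belongs to [E], so an orbit avoiding [E] is bounded. *)
    right; exists 0%N, (r + 1 + s) => k; rewrite addn0 leNgt; apply/negP => big.
    apply: (noE k); have [ka _] := iter_ascent k nz xa; split => //.
    by split; [lra|apply: higher; lra].
  + case: other => [|_]; first by left.
    right; have t0 : 0 <= r + 1 + s + 1 by lra.
    have [x xr] := @exists_normr R d _ (ltnW d2) t0.
    have [xa _] : off_charges a x /\ potential q a x < 0 by apply: far; lra.
    by exists x => //; split => //; split; [lra|apply: higher; lra].
- have {}other : exists2 j, j != i & 0 < q j by case: other => //; lra.
  have [r r0 pos] := potential_infty_pos a Q.
  apply: (@two_sinks R d n q a i set0) => //; last by left.
  + move=> x xa; right.
    have [|/existsNP[l /negP]] := pselect (forall k, `|iter k (ascent q a) x| <= r).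
      by move=> h; exists 0%N, r => k; rewrite addn0.
    (* From time [l] on the potential is at least its positive value at that time, but beyond radius
       [s] it is below that value. *)
    rewrite -ltNge => lr; have f0 := pos _ (ltW lr).
    have [s s0 small] := @potential_infty_small _ _ _ q a _ f0.
    exists l, s => k; rewrite leNgt; apply/negP => ks.
    have [_] := small _ (ltW ks); apply/negP; rewrite -leNgt.
    have [la _] := iter_ascent l nz xa; have [_ h] := iter_ascent k nz la.
    by rewrite iterD; apply: le_trans h (ler_norm _).
Qed.

(** * Charges on a line *)

Section line.
Variables (R : realType) (n : nat) (a : 'I_n -> 'rV[R]_1).
Implicit Types (q : 'I_n -> R) (s t u : R).

Let free s t := forall i u, s <= u <= t -> u != a i 0 0.

(** The derivative of the potential along the line, so the physical force on a positive unit charge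
    with its sign reversed. *)
Let force q s := field q a (const_mx s) 0 0.

Lemma off_charges_line s : (forall i, s != a i 0 0) -> off_charges a (const_mx s).
Proof.
by move=> h i; apply: contraNneq (h i) => <-; rewrite mxE.
Qed.

Lemma normr_line s i : `|const_mx s - a i| = `|s - a i 0 0|.
Proof.
apply/le_anti/andP; split.
  by apply: normr_le_coord => // j; rewrite !mxE ord1.
by have := normr_coord (const_mx s - a i) 0; rewrite !mxE.
Qed.

Lemma dist_line i k : `|a i - a k| = `|a i 0 0 - a k 0 0|.
Proof.
rewrite -normr_line; congr `|_ - _|.
by apply/rowP => j; rewrite mxE ord1.
Qed.

Lemma normr_const_line s : `|const_mx s : 'rV[R]_1| = `|s|.
Proof.
apply/le_anti/andP; split; first by apply: normr_le_coord => // j; rewrite mxE.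
by have := normr_coord (const_mx s : 'rV[R]_1) 0; rewrite mxE.
Qed.

Lemma const_mxZ s : const_mx s = s *: const_mx 1 :> 'rV[R]_1.
Proof. by apply/rowP => j; rewrite !mxE mulr1. Qed.

Lemma potential_line_MVT q s t :
  s <= t -> free s t ->
  exists2 u, s <= u <= t &
    potential q a (const_mx t) - potential q a (const_mx s) = force q u * (t - s).
Proof.
move=> st fr.
have seg u : const_mx s + u *: const_mx (t - s) = const_mx (s + u * (t - s)) :> 'rV[R]_1.
  by apply/rowP => j; rewrite !mxE.
have inseg u : 0 <= u <= 1 -> s <= s + u * (t - s) <= t by nra.
have [u u01|u u01 e] := @potential_MVT R 1 n q a (const_mx s) (const_mx (t - s)).
  by rewrite seg; apply: off_charges_line => i; apply: fr; exact: inseg.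
exists (s + u * (t - s)); first exact: inseg.
move: e; rewrite seg -{1}[const_mx (t - s)]scale1r seg mul1r subrKC => ->.
by rewrite /dot big_ord1 mxE.
Qed.

Lemma force_continuous q s :
  (forall i, s != a i 0 0) -> {for s, continuous (force q)}.
Proof.
move=> /off_charges_line sa.
apply: (@continuous_comp _ _ _ (fun u => field q a (const_mx u))
  (fun x : 'rV[R]_1 => x 0 0)).
  apply: (@continuous_comp _ _ _ (fun u => const_mx u) (field q a)).
    have -> : (fun u => const_mx u : 'rV[R]_1) = fun u => u *: const_mx 1.
      by apply/funext => u; rewrite const_mxZ.
    apply: (@continuousZ _ _ _ (@id R) (cst (const_mx 1))); last exact: cst_continuous.
    by move=> A.
  exact: field_continuous.
exact: coord_continuous.
Qed.

(** A change of sign on an interval without charges would give a zero by the intermediate value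
    theorem. *)
Lemma force_sign q s t :
  (forall u, (forall i, u != a i 0 0) -> force q u != 0) ->
  s <= t -> free s t -> (0 < force q s) = (0 < force q t).
Proof.
move=> nz st fr.
have cont : {within `[s, t], continuous (force q)}.
  apply: continuous_in_subspaceT => u; rewrite inE /= in_itv /= => ust.
  by apply: force_continuous => i; exact: fr.
have nz0 u : s <= u <= t -> force q u != 0.
  by move=> ust; apply: nz => i; exact: fr.
have nzs : force q s != 0 by apply: nz0; rewrite lexx.
have nzt : force q t != 0 by apply: nz0; rewrite lexx andbT.
have noc : ~ (Num.min (force q s) (force q t) <= 0 <= Num.max (force q s) (force q t)).
  by move=> /(IVT st cont)[c]; rewrite in_itv /= => /nz0 /negP h /eqP; exact: h.
case: (ltgtP 0 (force q s)) nzs => //= hs _;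
  case: (ltgtP 0 (force q t)) nzt => //= ht _.
  by case: noc; rewrite ge_min le_max (ltW hs) (ltW ht) orbT.
by case: noc; rewrite ge_min le_max (ltW hs) (ltW ht) orbT.
Qed.

(** Just left of the charge the potential exceeds its value at [s], so the force is positive
    somewhere in between, and its sign is constant there. *)
Lemma force_left_of_pos q m s :
  injective a ->
  (forall u, (forall i, u != a i 0 0) -> force q u != 0) ->
  0 < q m -> s < a m 0 0 -> (forall i u, s <= u < a m 0 0 -> u != a i 0 0) ->
  0 < force q s.
Proof.
move=> inja nz qm sm fr.
have [r r0 h] := potential_near_pos (potential q a (const_mx s)) inja qm.
pose e := Num.min r (a m 0 0 - s) / 2.
have m0 : 0 < Num.min r (a m 0 0 - s) by rewrite lt_min r0 subr_gt0.
have mr : Num.min r (a m 0 0 - s) <= r by rewrite ge_min lexx.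
have ms : Num.min r (a m 0 0 - s) <= a m 0 0 - s by rewrite ge_min lexx orbT.
pose t := a m 0 0 - e.
have st : s < t by rewrite /t /e; lra.
have tm : t < a m 0 0 by rewrite /t /e; lra.
have frt : free s t by move=> i u ust; apply: fr; lra.
have ta : const_mx t != a m by apply: off_charges_line => i; apply: frt; lra.
have tr : `|const_mx t - a m| < r.
  by rewrite normr_line ltr0_norm /t /e; lra.
have [u ust] := potential_line_MVT q (ltW st) frt.
have := h _ ta tr; move: (potential _ _ _) (potential _ _ _) => p1 p2 p12 e12.
rewrite (@force_sign _ s u) //; [nra|lra|].
by move=> i w hw; apply: frt; lra.
Qed.

Lemma force_right_of_pos q m s :
  injective a ->
  (forall u, (forall i, u != a i 0 0) -> force q u != 0) ->
  0 < q m -> a m 0 0 < s -> (forall i u, a m 0 0 < u <= s -> u != a i 0 0) ->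
  force q s < 0.
Proof.
move=> inja nz qm sm fr.
have [r r0 h] := potential_near_pos (potential q a (const_mx s)) inja qm.
pose e := Num.min r (s - a m 0 0) / 2.
have m0 : 0 < Num.min r (s - a m 0 0) by rewrite lt_min r0 subr_gt0.
have mr : Num.min r (s - a m 0 0) <= r by rewrite ge_min lexx.
have ms : Num.min r (s - a m 0 0) <= s - a m 0 0 by rewrite ge_min lexx orbT.
pose t := a m 0 0 + e.
have st : t < s by rewrite /t /e; lra.
have tm : a m 0 0 < t by rewrite /t /e; lra.
have frt : free t s by move=> i u ust; apply: fr; lra.
have ta : const_mx t != a m by apply: off_charges_line => i; apply: frt; lra.
have tr : `|const_mx t - a m| < r.
  by rewrite normr_line gtr0_norm /t /e; lra.
have [u ust] := potential_line_MVT q (ltW st) frt.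
have := h _ ta tr; move: (potential _ _ _) (potential _ _ _) => p1 p2 p12 e12.
rewrite lt_neqAle nz /=; last by move=> i; apply: frt; lra.
rewrite leNgt -(@force_sign _ u s) //; [|lra|].
  by rewrite -leNgt; nra.
by move=> i w hw; apply: frt; lra.
Qed.

(** The potential is positive at some far [t] and smaller than that at a still farther [t'], so it
    increases somewhere between them. *)
Lemma force_far_left q s :
  (forall u, (forall i, u != a i 0 0) -> force q u != 0) ->
  0 < \sum_i q i -> (forall i, s < a i 0 0) -> 0 < force q s.
Proof.
move=> nz Q sa.
have fr t u : u <= s -> free t u.
  by move=> us i w /andP[_ wu]; have sai := sa i; rewrite lt_eqF //; lra.
have [r r0 pos] := potential_infty_pos a Q.
pose t := - (r + `|s|).
have ts : t <= s by have := ler_norm (- s); rewrite normrN /t; lra.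
have tr : r <= `|const_mx t : 'rV[R]_1|.
  by rewrite normr_const_line /t normrN ger0_norm; have := normr_ge0 s; lra.
have [r' r'0 small] := @potential_infty_small R 1 n q a _ (pos _ tr).
pose t' := - (r' + `|t| + 1).
have tt' : t' < t by have := ler_norm (- t); rewrite normrN /t'; lra.
have tr' : r' <= `|const_mx t' : 'rV[R]_1|.
  by rewrite normr_const_line /t' normrN ger0_norm; have := normr_ge0 t; lra.
have [_] := small _ tr'; rewrite ltr_norml => /andP[_].
have [u ut] := potential_line_MVT q (ltW tt') (fr _ _ ts).
move: (potential _ _ _) (potential _ _ _) => p1 p2 p12 e12.
rewrite -(@force_sign _ u s) //; [nra|lra|exact: fr].
Qed.

Lemma force_far_right q s :
  (forall u, (forall i, u != a i 0 0) -> force q u != 0) ->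
  0 < \sum_i q i -> (forall i, a i 0 0 < s) -> force q s < 0.
Proof.
move=> nz Q sa.
have fr t u : s <= t -> free t u.
  by move=> us i w /andP[wu _]; have sai := sa i; rewrite gt_eqF //; lra.
have [r r0 pos] := potential_infty_pos a Q.
pose t := r + `|s|.
have ts : s <= t by have := ler_norm s; rewrite /t; lra.
have tr : r <= `|const_mx t : 'rV[R]_1|.
  by rewrite normr_const_line /t ger0_norm; have := normr_ge0 s; lra.
have [r' r'0 small] := @potential_infty_small R 1 n q a _ (pos _ tr).
pose t' := r' + `|t| + 1.
have tt' : t < t' by have := ler_norm t; rewrite /t'; lra.
have tr' : r' <= `|const_mx t' : 'rV[R]_1|.
  by rewrite normr_const_line /t' ger0_norm; have := normr_ge0 t; lra.
have [_] := small _ tr'; rewrite ltr_norml => /andP[_].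
have [u ut] := potential_line_MVT q (ltW tt') (fr _ _ ts).
move: (potential _ _ _) (potential _ _ _) => p1 p2 p12 e12.
rewrite lt_neqAle nz /=; last by move=> i; rewrite gt_eqF.
rewrite leNgt (@force_sign _ s u) //; [|lra|exact: fr].
by rewrite -leNgt; nra.
Qed.

Let pos_left q s := #|[pred i | (0 < q i) && (a i 0 0 < s)]|.
Let neg_left q s := #|[pred i | (q i < 0) && (a i 0 0 < s)]|.

(* Crossing a charge flips the sign of the force, so to the left of a point the
   two kinds of charges balance exactly or up to one positive charge. *)
Lemma force_left_count q s :
  injective a -> (forall i, q i != 0) ->
  (forall u, (forall i, u != a i 0 0) -> force q u != 0) ->
  0 < \sum_i q i -> (forall i, s != a i 0 0) ->
  pos_left q s = (neg_left q s + (force q s < 0)%R)%N.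
Proof.
move=> inja q0 nz Q.
(* Induction on the number of charges to the left of [s], removing the rightmost of them, [m]. *)
have [N] := ubnP #|[pred i | a i 0 0 < s]|; elim: N s => // N IH s sN sa.
have [i0 i0s|none] := pickP (fun i => a i 0 0 < s); last first.
  have f0 : 0 < force q s.
    apply: force_far_left => // i; rewrite lt_neqAle sa leNgt.
    by have /= -> := none i.
  have none0 (P : pred 'I_n) : #|[pred i | P i && (a i 0 0 < s)]| = 0%N.
    by apply: eq_card0 => i; have /= ni := none i; rewrite !inE ni andbF.
  rewrite /pos_left /neg_left (none0 (fun i => 0 < q i)).
  by rewrite (none0 (fun i => q i < 0)) ltNge ltW.
have [m ms mmax] : exists2 m, a m 0 0 < s &
    forall i, a i 0 0 < s -> a i 0 0 <= a m 0 0.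
  by have [m] := @arg_maxP _ _ _ i0 (fun i => a i 0 0 < s) (fun i => a i 0 0) i0s;
    exists m.
have [t t0 sep] := separation inja.
(* Half the separation puts [s'] between [m] and the preceding charge, if any. *)
pose s' := a m 0 0 - t / 2.
have below i : (a i 0 0 < s') = (a i 0 0 < s) && (i != m).
  have [->|im] := eqVneq i m; first by rewrite andbF /s'; apply/negP; lra.
  rewrite andbT; apply/idP/idP => [|/mmax im']; first by rewrite /s'; lra.
  by have := sep _ _ im; rewrite dist_line ler0_norm /s'; lra.
have outer i u : s' <= u < a m 0 0 -> u != a i 0 0.
  move=> /andP[u1 u2]; apply/eqP => e.
  have [im|im] := eqVneq i m; first by move: u2; rewrite e im ltxx.
  have : a i 0 0 < s' by rewrite below im andbT -e; lra.
  by rewrite -e; lra.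
have s'a i : s' != a i 0 0.
  by apply: outer; rewrite lexx /s' /=; lra.
have outer' i u : a m 0 0 < u <= s -> u != a i 0 0.
  move=> /andP[u1 u2]; apply: contraTneq u1 => e; rewrite -leNgt.
  by rewrite e; apply: mmax; rewrite lt_neqAle eq_sym sa /= -e.
have step (P : pred 'I_n) :
    #|[pred i | P i && (a i 0 0 < s)]| = (P m + #|[pred i | P i && (a i 0 0 < s')%R]|)%N.
  rewrite (cardD1 m) inE /= ms andbT; congr (_ + _)%N; apply: eq_card => i.
  by rewrite !inE below; case: (i != m); rewrite ?andbT ?andbF.
have {IH} := IH s' _ s'a.
have /= stepT := step xpredT.
rewrite (_ : #|[pred i | a i 0 0 < s]| = #|[pred i | a i 0 0 < s']|.+1) in sN; last first.
  exact: stepT.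
move=> /(_ sN); rewrite /pos_left /neg_left !step.
have s'm : s' < a m 0 0 by rewrite /s'; lra.
have qm0 := q0 m.
have [qm|qm|/eqP] := ltgtP (q m) 0; last by rewrite (negbTE qm0).
  (* With all charges reversed [m] is positive, so the one-sided lemmas apply to the opposite
     force. *)
  have qm' : 0 < - q m by rewrite oppr_gt0.
  have nz' u : (forall i, u != a i 0 0) -> force (fun i => - q i) u != 0.
    by move=> ua; rewrite /force fieldN mxE oppr_eq0; exact: nz.
  have f1 : force q s' < 0.
    have := force_left_of_pos inja nz' qm' s'm outer.
    by rewrite /force fieldN mxE oppr_gt0.
  have f2 : 0 < force q s.
    have := force_right_of_pos inja nz' qm' ms outer'.
    by rewrite /force fieldN mxE oppr_lt0.
  rewrite f1 ltNge (ltW f2) /= => ->.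
  by rewrite add0n addn0 addnC.
have f1 := force_left_of_pos inja nz qm s'm outer.
rewrite (force_right_of_pos inja nz qm ms outer') ltNge (ltW f1) /= => ->.
by rewrite add0n addn0 addnC.
Qed.

(** To the right of all charges the force is negative, which is the unbalanced case of
    [force_left_count]. *)
Lemma line_count q :
  injective a -> (forall i, q i != 0) ->
  (forall u, (forall i, u != a i 0 0) -> force q u != 0) ->
  0 < \sum_i q i -> num_pos q = (num_neg q + 1)%N.
Proof.
move=> inja q0 nz Q; pose s := \sum_i `|a i 0 0| + 1.
have sa i : a i 0 0 < s.
  rewrite /s (bigD1 i) //=; have := ler_norm (a i 0 0).
  have : 0 <= \sum_(j < n | j != i) `|a j 0 0| by exact: sumr_ge0.
  lra.
have ep : pos_left q s = num_pos q.
  by apply: eq_card => i; rewrite !inE sa andbT.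
have en : neg_left q s = num_neg q.
  by apply: eq_card => i; rewrite !inE sa andbT.
rewrite -ep -en (@force_left_count q s) //; last by move=> i; rewrite gt_eqF.
by rewrite (force_far_right nz Q sa).
Qed.
End line.

(** * Reduction to positive total charge and split by dimension *)

Unset Implicit Arguments.

Theorem corollaryB2 (R : realType) (d n : nat)
    (q : 'I_n -> R) (a : 'I_n -> 'rV[R]_d)
    (n_ge2 : (2 <= n)%N)
    (a_distinct : injective a)
    (q_neq0 : forall i, q i != 0)
    (cases :
      (~~ odd d /\ \sum_(i < n) q i != 0) \/
      (odd d /\
        ((0 < \sum_(i < n) q i /\ num_pos q <> (num_neg q + 1)%N) \/
         (\sum_(i < n) q i < 0 /\ num_neg q <> (num_pos q + 1)%N)))) :
  exists x : 'rV[R]_d, equilibrium_point q a x.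
Proof.
(* Reversing all charges negates the field, exchanges the two counts and preserves equilibrium
   points. *)
wlog Q : q q_neq0 cases / 0 < \sum_(i < n) q i.
  move=> pos; have [Q|Q|Q] := ltgtP (\sum_(i < n) q i) 0; last 2 first.
  - exact: pos.
  - by case: cases => -[_]; rewrite Q ?eqxx // => -[] []; rewrite ltxx.
  have Nq : num_pos (fun i => - q i) = num_neg q.
    by apply: eq_card => i; rewrite !inE oppr_gt0.
  have Pq : num_neg (fun i => - q i) = num_pos q.
    by apply: eq_card => i; rewrite !inE oppr_lt0.
  have [||| x [xa _ gx]] := pos (fun i => - q i).
  - by move=> i; rewrite oppr_eq0.
  - rewrite sumrN oppr_eq0 oppr_gt0 oppr_lt0 Nq Pq.
    by case: cases => [|[od [|]]]; [left|right; split => //; right|right; split => //; left].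
  - by rewrite sumrN oppr_gt0.
  exists x; split => //; first exact: differentiable_potential.
  rewrite gradient_potential //; apply/eqP; rewrite -oppr_eq0 -fieldN.
  by rewrite -gradient_potential // gx.
suff [x xa fx] : exists2 x, off_charges a x & field q a x = 0.
  by exists x; split => //; [exact: differentiable_potential|rewrite gradient_potential].
case: (ltngtP d 1) => d1.
(* In dimension 0 the space is a single point, which cannot carry two distinct charges. *)
- case: d d1 a a_distinct {cases} => // _ a inja.
  have /inja/(congr1 val) : a (Ordinal (ltnW n_ge2)) = a (Ordinal n_ge2) by rewrite !thinmx0.
  by [].
- have [i qi] : exists i, 0 < q i.
    apply: contrapT => /forallNP h; move: Q; rewrite ltNge => /negP; apply.
    by apply: sumr_le0 => i _; rewrite leNgt; apply/negP.
  have [j ji] : exists j, j != i.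
    have [i0|i0] := eqVneq (val i) 0%N.
      by exists (Ordinal n_ge2); rewrite -val_eqE /= i0.
    by exists (Ordinal (ltnW n_ge2)); rewrite -val_eqE /= eq_sym.
  (* If [q j] is negative, reversing the charges makes it positive and the total negative, so
     infinity is the second sink; otherwise [j] is a second positive charge. *)
  have [qj|qj|/eqP] := ltgtP (q j) 0; last by rewrite (negbTE (q_neq0 j)).
    have [||||x xa] := @has_field_zero R d n (fun i => - q i) a j d1 a_distinct.
    + by move=> k; rewrite oppr_eq0.
    + by rewrite oppr_gt0.
    + by rewrite sumrN oppr_eq0 gt_eqF.
    + by right; rewrite sumrN oppr_lt0.
    by rewrite fieldN => /eqP; rewrite oppr_eq0 => /eqP fx; exists x.
  apply: (@has_field_zero R d n q a i) => //; first by rewrite gt_eqF.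
  by left; exists j.
(* In dimension 1 only the odd case with positive total remains, and a force without zeros would
   force the excluded count. *)
subst d; case: cases => [[]//|[_ [[_ count]|[]]]]; last by rewrite ltNge ltW.
apply: contrapT => nex; apply: count; apply: (line_count a_distinct q_neq0 _ Q).
move=> u ua; apply: contra_notN nex => /eqP f0.
exists (const_mx u); first exact: off_charges_line.
by apply/rowP => j; rewrite ord1 f0 mxE.
Qed.
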